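(* Let $X=(X_1,X_2)$ be a two-good random valuation whose two coordinates $X_1,X_2$ are independent. Then \[ \frac{\textsc{SRev}(X_1,X_2)}{\textsc{Rev}(X_1,X_2)}\;\geq\;\frac{\sqrt{e}}{\sqrt{e}+1}\approx 0.62 . \]
   Context: A $k$-good random valuation is a random vector $X=(X_1,\dots,X_k)$ taking values in $\mathbb{R}_+^k$ (the buyer's values for the goods; the buyer's value for a set of goods is the sum of the values). A (direct) mechanism is a pair $\mu=(q,s)$ of Borel functions $q=(q_1,\dots,q_k):\mathbb{R}_+^k\to[0,1]^k$ (allocation probabilities) and $s:\mathbb{R}_+^k\to\mathbb{R}$ (payment); the buyer's payoff is $b(x)=q(x)\cdot x-s(x)$. The mechanism is individually rational (IR) if $b(x)\ge 0$ for all $x\in\mathbb{R}_+^k$, and incentive compatible (IC) if $b(x)\ge q(\tilde x)\cdot x-s(\tilde x)$ for all $x,\tilde x\in\mathbb{R}_+^k$. The revenue of $\mu$ from $X$ is $R(\mu;X)=\mathbb{E}[s(X)]$, and $\textsc{Rev}(X)=\sup_\mu R(\mu;X)$ over all IC and IR mechanisms. For a one-good valuation this is the optimal one-good revenue, and $\textsc{SRev}(X)=\textsc{Rev}(X_1)+\dots+\textsc{Rev}(X_k)$ is the separate-selling revenue. *)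

(* Defs.v *)
From mathcomp Require Import all_boot all_order all_algebra.
From mathcomp Require Import all_classical all_reals all_analysis.
Set Implicit Arguments. Unset Strict Implicit. Unset Printing Implicit Defensive.
Import Order.TTheory GRing.Theory Num.Theory.
Local Open Scope classical_set_scope.
Local Open Scope ring_scope.

Section mech.
Variable R : realType.

(** One-good direct mechanisms: allocation probability q, payment s, both Borel.
    Valuations range over R_+ ; the constraints are imposed on R_+. *)
Definition mechanism1 (q s : R -> R) : Prop :=
  [/\ measurable_fun setT q, measurable_fun setT s,
      (forall x, 0 <= x -> 0 <= q x <= 1),
      (* IR *) (forall x, 0 <= x -> 0 <= q x * x - s x) &
      (* IC *) (forall x y, 0 <= x -> 0 <= y ->
                  q y * x - s y <= q x * x - s x)].

Definition mechanism2 (q1 q2 s : R * R -> R) : Prop :=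
  [/\ measurable_fun setT q1 /\ measurable_fun setT q2, measurable_fun setT s,
      (forall x : R * R, 0 <= x.1 -> 0 <= x.2 ->
          0 <= q1 x <= 1 /\ 0 <= q2 x <= 1),
      (* IR *) (forall x : R * R, 0 <= x.1 -> 0 <= x.2 ->
          0 <= q1 x * x.1 + q2 x * x.2 - s x) &
      (* IC *) (forall x y : R * R, 0 <= x.1 -> 0 <= x.2 -> 0 <= y.1 -> 0 <= y.2 ->
          q1 y * x.1 + q2 y * x.2 - s y <= q1 x * x.1 + q2 x * x.2 - s x)].

Context {d : measure_display} {T : measurableType d} (P : probability T R).

Definition Rev1 (Y : T -> R) : \bar R :=
  ereal_sup [set r | exists q s, mechanism1 q s /\
                     r = (\int[P]_w (s (Y w))%:E)%E].

Definition Rev2 (X1 X2 : T -> R) : \bar R :=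
  ereal_sup [set r | exists q1 q2 s, mechanism2 q1 q2 s /\
                     r = (\int[P]_w (s (X1 w, X2 w))%:E)%E].

Definition SRev2 (X1 X2 : T -> R) : \bar R := (Rev1 X1 + Rev1 X2)%E.

Definition independent2 (X1 X2 : T -> R) : Prop :=
  forall A B : set R, measurable A -> measurable B ->
    P (X1 @^-1` A `&` X2 @^-1` B) = (P (X1 @^-1` A) * P (X2 @^-1` B))%E.

End mech.

(* Main.v *)
From HB Require Import structures.
Require Import Defs.
From mathcomp Require Import all_boot all_order all_algebra.
From mathcomp Require Import all_classical all_reals all_analysis.
From mathcomp Require Import measurable_realfun ring lra.
Set Implicit Arguments. Unset Strict Implicit. Unset Printing Implicit Defensive.
Import Order.TTheory GRing.Theory Num.Theory.
Local Open Scope classical_set_scope.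
Local Open Scope ring_scope.

(** Let b be the payoff of a two-good mechanism with payment s, and let Y and M
    be the minimum and the maximum of X1 and X2. On X1 >= X2 write
      s = [q1 X1 - b(X) + b(X2, X2)] + [q2 X2 - b(X2, X2)].
    For fixed X2 the first bracket, extended by 0 below X2, is the payment of a
    one-good mechanism, so by independence its mean is at most r1 = Rev(X1);
    the region X2 > X1 is symmetric. Put h(t) = min(1, (q1 + q2)(t, t)). Then
    the second bracket is at most h(M) Y - b(Y, Y), and since b grows along the
    diagonal at rate at least h, slicing h into levels bounds it by an average
    over a of 1[M >= a] min(Y, a). The mean of that variable only involves the
    tails and truncated means of the single goods, P(Xi >= a) <= ri / a and
    E min(Xi, a) <= ri (1 + ln (a / ri)), and these give at most
    (r1 + r2) / sqrt e. In total Rev <= (r1 + r2) (1 + 1 / sqrt e). *)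

(** * Logarithmic inequalities and the bound on the truncated cross terms *)

Lemma ln_le_sub1 (R : realType) (x : R) : 0 < x -> ln x <= x - 1.
Proof.
move=> x0; have := @le_ln1Dx R (x - 1).
by rewrite (_ : 1 + (x - 1) = x); [apply; lra|ring].
Qed.

(** This is [ln x <= x - 1] at x = v / sqrt e, with equality at v = sqrt e; the constant sqrt e of
    the final ratio enters here. *)
Lemma ler_half_ln (R : realType) (v : R) :
  0 < v -> 2^-1 + ln v <= v / Num.sqrt (expR 1).
Proof.
move=> v0.
have e0 : 0 < Num.sqrt (expR 1 : R) by rewrite sqrtr_gt0 expR_gt0.
have lne : ln (Num.sqrt (expR 1 : R)) = 2^-1.
  have : ln (Num.sqrt (expR 1 : R) ^+ 2) = 1.
    by rewrite sqr_sqrtr ?expR_ge0// expRK.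
  rewrite lnXn// mulr2n => h; lra.
have := ln_le_sub1 (divr_gt0 v0 e0).
rewrite ln_div ?posrE// lne; lra.
Qed.

(** [p_i] and [m_i] stand for P(Xi >= a) and E min(Xi, a). When both [r_i < a],
    the extremal case is Xi equal-revenue truncated at a, and the left-hand side
    is (r1 r2 / a) (1 + ln (a / r1) + ln (a / r2)). *)
Lemma trunc_cross_bound (R : realType) (r1 r2 a p1 p2 m1 m2 : R) :
  0 < r1 -> 0 < r2 -> 0 < a ->
  0 <= p1 <= 1 -> 0 <= p2 <= 1 -> a * p1 <= r1 -> a * p2 <= r2 ->
  a * p1 <= m1 <= a -> a * p2 <= m2 <= a ->
  (r1 < a -> m1 <= r1 * (1 + ln (a / r1))) ->
  (r2 < a -> m2 <= r2 * (1 + ln (a / r2))) ->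
  p1 * m2 + p2 * (m1 - a * p1) <= (r1 + r2) / Num.sqrt (expR 1).
Proof.
move=> r10 r20 a0 /andP[p10 p11] /andP[p20 p21] pr1 pr2.
move=> /andP[pm1 ma1] /andP[pm2 ma2] M1 M2.
have H (v : R) : 0 < v -> 2^-1 + ln v <= v * (Num.sqrt (expR 1))^-1.
  exact: ler_half_ln.
set c := (Num.sqrt (expR 1))^-1 in H *.
have c2 : 2^-1 <= c by have := H 1 ltr01; rewrite ln1; lra.
case: (ltP r1 a) => [ra1|ra1]; case: (ltP r2 a) => [ra2|ra2].
- have {}M1 := M1 ra1; have {}M2 := M2 ra2.
  have H1 := H (a / r1) (divr_gt0 a0 r10); have H2 := H (a / r2) (divr_gt0 a0 r20).
  have L1 : 0 <= ln (a / r1) by apply: ln_ge0; rewrite ler_pdivlMr ?mul1r// ltW.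
  have L2 : 0 <= ln (a / r2) by apply: ln_ge0; rewrite ler_pdivlMr ?mul1r// ltW.
  set l1 := ln (a / r1) in M1 H1 L1; set l2 := ln (a / r2) in M2 H2 L2.
  pose P1 := r1 / a; pose P2 := r2 / a.
  have pP1 : p1 <= P1 by rewrite /P1 ler_pdivlMr// mulrC.
  have pP2 : p2 <= P2 by rewrite /P2 ler_pdivlMr// mulrC.
  have E1 : r1 = P1 * a by rewrite /P1 divfK// gt_eqF.
  have E2 : r2 = P2 * a by rewrite /P2 divfK// gt_eqF.
  have P10 : 0 < P1 by rewrite divr_gt0.
  have P20 : 0 < P2 by rewrite divr_gt0.
  clearbody P1 P2.
  (* The factor 1 + l1 + l2 of the extremal value splits into 1/2 + l1 and 1/2 + l2, each bounded by
     [ler_half_ln] at a / r_i. *)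
  have F1 : P1 * P2 * a * (2^-1 + l1) <= r2 * c.
    have -> : r2 * c = P1 * P2 * a * (a / r1 * c).
      by rewrite E1 E2; field; rewrite !gt_eqF.
    by apply: ler_wpM2l H1; rewrite !mulr_ge0// ltW.
  have F2 : P1 * P2 * a * (2^-1 + l2) <= r1 * c.
    have -> : r1 * c = P1 * P2 * a * (a / r2 * c).
      by rewrite E1 E2; field; rewrite !gt_eqF.
    by apply: ler_wpM2l H2; rewrite !mulr_ge0// ltW.
  (* The bound obtained from [M1] and [M2] is nondecreasing in p1 and then, at p1 = P1, in p2, so
     both tails may be raised to r_i / a. *)
  have A1 : p1 * m2 + p2 * (m1 - a * p1) <=
      p1 * (r2 * (1 + l2)) + p2 * (r1 * (1 + l1) - a * p1).
    by apply: lerD; apply: ler_wpM2l => //; lra.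
  have A2 : p1 * (r2 * (1 + l2) - a * p2) <= P1 * (r2 * (1 + l2) - a * p2).
    by apply: ler_wpM2r => //; have := mulr_ge0 (ltW r20) L2; lra.
  have A3 : p2 * (r1 * l1) <= P2 * (r1 * l1).
    by apply: ler_wpM2r => //; rewrite mulr_ge0// ltW.
  have A4 : P1 * a * p2 = r1 * p2 by rewrite -E1.
  have A5 : P1 * (r2 * (1 + l2)) + P2 * (r1 * l1) = P1 * P2 * a * (2^-1 + l1) + P1 * P2 * a * (2^-1 + l2).
    by rewrite E1 E2; field.
  lra.
(* Here m2 <= a, so the left-hand side is at most m1 <= r1 / 2 + r1 (1/2 + ln (a / r1)) <= c r1 + c
   a, and a <= r2. *)
- have {}M1 := M1 ra1.
  have H1 := H (a / r1) (divr_gt0 a0 r10).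
  have F1 : r1 * (2^-1 + ln (a / r1)) <= a * c.
    have -> : a * c = r1 * (a / r1 * c) by field; rewrite gt_eqF.
    by apply: ler_wpM2l H1; exact: ltW.
  have A1 : p1 * m2 <= p1 * a by apply: ler_wpM2l.
  have A2 : a * p1 * (1 - p2) <= m1 * (1 - p2) by apply: ler_wpM2r => //; lra.
  nra.
- have {}M2 := M2 ra2.
  have H2 := H (a / r2) (divr_gt0 a0 r20).
  have F2 : r2 * (2^-1 + ln (a / r2)) <= a * c.
    have -> : a * c = r2 * (a / r2 * c) by field; rewrite gt_eqF.
    by apply: ler_wpM2l H2; exact: ltW.
  have A1 : p2 * m1 <= p2 * a by apply: ler_wpM2l.
  have A2 : a * p2 * (1 - p1) <= m2 * (1 - p1) by apply: ler_wpM2r => //; lra.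
  nra.
(* With r1 and r2 both at least a, the left-hand side is at most m1 <= a, and c >= 1/2 suffices. *)
- have A1 : p1 * m2 <= p1 * a by apply: ler_wpM2l.
  have A2 : p2 * (m1 - a * p1) <= 1 * (m1 - a * p1) by apply: ler_wpM2r => //; lra.
  nra.
Qed.

(** * Slicing the slope along the diagonal into levels *)

Lemma min_le_count (R : realType) (u : R) (N : nat) : 0 <= u ->
  Num.min u N.+1%:R <= 1 + \sum_(j < N) (j.+1%:R <= u)%R%:R.
Proof.
move=> u0; elim: N => [|N IH]; first by rewrite big_ord0 addr0 ge_min lexx orbT.
rewrite big_ord_recr/=; have [h|h] := leP N.+1%:R u.
  rewrite (min_idPr h) in IH.
  apply: (@le_trans _ _ N.+2%:R); first by rewrite ge_min lexx orbT.
  by rewrite -(natr1 N.+1) mulr1n; lra.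
rewrite addr0; apply: le_trans IH.
by rewrite (min_idPl (ltW h)) ge_min lexx.
Qed.

(** [B] plays the diagonal payoff b(t, t) and [q] a lower bound on its slope;
    [a j] is the infimum of the points where [q] reaches the level (j + 1) / n,
    or the junk value 0, whose term vanishes, when [q] never does. *)
Section layer_cake.
Variables (R : realType) (q B : R -> R).
Hypothesis q01 : forall t, 0 <= t -> 0 <= q t <= 1.
Hypothesis B0 : forall t, 0 <= t -> 0 <= B t.
Hypothesis Bq : forall t t', 0 <= t -> t <= t' -> B t + q t * (t' - t) <= B t'.

Let lev (l : R) := [set t | 0 <= t /\ l <= q t].

Let lev_has_inf l t : lev l t -> has_inf (lev l).
Proof. by move=> h; split; [exists t|exists 0 => x []]. Qed.

Let inf_lev_ge0 l t : lev l t -> 0 <= inf (lev l).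
Proof. by move=> h; apply: lb_le_inf; [exists t|move=> x []]. Qed.

Let inf_lev_le l t : lev l t -> inf (lev l) <= t.
Proof. by move=> h; apply: ge_inf => //; exists 0 => x []. Qed.

Let B_above_level l t y : lev l t -> l <= 1 -> inf (lev l) <= y ->
  B (inf (lev l)) + l * (y - inf (lev l)) <= B y.
Proof.
move=> lt l1 ay; set a := inf _ in ay *.
have a0 : 0 <= a by exact: inf_lev_ge0 lt.
(* The infimum need not lie in the level set; the slope l is used only from a point t' within e of
   it, and l <= 1 keeps the loss below e. *)
apply/ler_addgt0Pr => e e0.
have [t' [t'0 lt'] t'a] := inf_adherent e0 (lev_has_inf lt).
have at' : a <= t' by apply: inf_lev_le; split.
have [yt'|t'y] := leP y t'.
  have := Bq a0 ay; have /andP[qa _] := q01 a0.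
  have : 0 <= q a * (y - a) by rewrite mulr_ge0// subr_ge0.
  have : l * (y - a) <= 1 * (y - a) by rewrite ler_wpM2r// subr_ge0.
  rewrite -/a in t'a; lra.
have := Bq t'0 (ltW t'y).
have : l * (y - t') <= q t' * (y - t') by rewrite ler_wpM2r// subr_ge0 ltW.
have := Bq a0 at'; have /andP[qa _] := q01 a0.
have : 0 <= q a * (t' - a) by rewrite mulr_ge0// subr_ge0.
have : l * (t' - a) <= 1 * (t' - a) by rewrite ler_wpM2r// subr_ge0.
rewrite -/a in t'a; lra.
Qed.

(** At least n q(m) - 1 levels are reached at m, and the excesses max(y - a_j, 0) sum to at most n
    B(y). For a level reached, y minus its excess is min(y, a_j); the term y / n is the rounding
    error. *)
Lemma layer_cake_bound (n : nat) : (0 < n)%N ->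
  exists a : nat -> R, (forall j, 0 <= a j) /\
    forall y m, 0 <= y -> y <= m ->
    q m * y - B y <=
      y / n%:R + n%:R^-1 * \sum_(j < n) (a j <= m)%R%:R * Num.min y (a j).
Proof.
move=> n0; have n0' : 0 < n%:R :> R by rewrite ltr0n.
pose l (j : nat) : R := j.+1%:R / n%:R.
pose a (j : nat) : R := if `[< lev (l j) !=set0 >] then inf (lev (l j)) else 0.
pose dd (j : nat) (y : R) : R :=
  if `[< lev (l j) !=set0 >] then Num.max (y - a j) 0 else 0.
have a0 j : 0 <= a j.
  by rewrite /a; case: asboolP => // -[t lt]; exact: inf_lev_ge0 lt.
have ddlip j x y : x <= y -> dd j y <= dd j x + (y - x).
  move=> xy; rewrite /dd; case: asboolP => _; last by lra.
  by rewrite ge_max; apply/andP; split; rewrite -lerBlDr le_max; lra.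
(* Induction on levels: past the threshold of level k, B gains at least (k + 1) / n per unit, enough
   for k + 1 excesses of slope at most 1; before it, the new excess is zero. *)
have Bdd k : (k <= n)%N -> forall y, 0 <= y -> n%:R^-1 * \sum_(j < k) dd j y <= B y.
  elim: k => [|k IH] kn y y0; first by rewrite big_ord0 mulr0; exact: B0.
  rewrite big_ord_recr/=.
  have {}IH := IH (ltnW kn).
  have lk1 : l k <= 1 by rewrite /l ler_pdivrMr// mul1r ler_nat.
  rewrite [dd k y]/dd; case: asboolP => [[t lt]|_]; last by rewrite addr0; exact: IH.
  have ak : a k = inf (lev (l k)).
    by rewrite /a; case: asboolP => // -[]; exists t.
  rewrite ak; have := a0 k; rewrite ak; set b := inf _ => b0.
  have [yb|by_] := leP y b.
    by rewrite max_r ?addr0; [exact: IH|lra].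
  rewrite max_l; last by lra.
  apply: le_trans (B_above_level lt lk1 (ltW by_)).
  rewrite -/b; apply: (@le_trans _ _ (n%:R^-1 * (\sum_(j < k) (dd j b + (y - b)) + (y - b)))).
    rewrite ler_pM2l ?invr_gt0// lerD2r; apply: ler_sum => j _.
    by apply: ddlip; exact: ltW.
  rewrite big_split/= sumr_const card_ord -addrA -mulrSr mulrDr.
  apply: lerD; first exact: IH.
  by rewrite -(mulr_natl (y - b)) mulrA (mulrC _^-1).
exists a; split=> // y m y0 ym.
have m0 : 0 <= m by lra.
have /andP[qm0 qm1] := q01 m0.
have qm : q m <= n%:R^-1 * (1 + \sum_(j < n) (l j <= q m)%R%:R).
  have := @min_le_count R (n%:R * q m) n (mulr_ge0 (ltW n0') qm0).
  (* Since n q(m) <= n, the cap n + 1 is inactive. *)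
  rewrite min_l; last by rewrite -natr1; nra.
  move=> h; rewrite -(ler_pM2l n0') mulrA divff ?gt_eqF// mul1r.
  apply: le_trans h _; rewrite lerD2l; apply: ler_sum => j _.
  by rewrite /l ler_pdivrMr// mulrC.
have := Bdd n (leqnn n) y y0 => By.
have := ler_wpM2r y0 qm => qmy.
suff : \sum_(j < n) (l j <= q m)%R%:R * y - \sum_(j < n) dd j y <=
    \sum_(j < n) (a j <= m)%R%:R * Num.min y (a j).
  rewrite -(ler_pM2l (_ : 0 < n%:R^-1)) ?invr_gt0// -mulr_suml => h.
  rewrite mulrBr in h; rewrite mulrDr mulr1 mulrDl -mulrA (mulrC _ y) in qmy.
  lra.
rewrite -sumrB; apply: ler_sum => j _.
have min0 : 0 <= Num.min y (a j) by rewrite le_min y0 a0.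
have R0 : 0 <= (a j <= m)%R%:R * Num.min y (a j) by rewrite mulr_ge0.
have d0 : 0 <= dd j y by rewrite /dd; case: asboolP => // _; rewrite le_max lexx orbT.
have [lq|lq] := leP (l j) (q m); last by rewrite mul0r; lra.
have lm : lev (l j) m by split.
have am : a j <= m.
  by rewrite /a; case: asboolP => // _; exact: inf_lev_le.
rewrite am !mul1r /dd; case: asboolP => [_|[]]; last by exists m.
by have [|] := leP y (a j); have [|] := leP (y - a j) 0; lra.
Qed.

End layer_cake.

(** * One-good mechanisms whose revenue controls tails and truncated means *)

Lemma posted_price_mechanism1 (R : realType) (a : R) : 0 <= a ->
  mechanism1 (fun x : R => (a <= x)%R%:R) (fun x => a * (a <= x)%R%:R).
Proof.
move=> a0; have mi : measurable_fun setT (fun x : R => (a <= x)%R%:R : R).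
  rewrite (_ : (fun _ => _) = (fun x => if a <= x then 1 else 0)); last first.
    by apply/funext => x; case: (a <= x).
  by apply: measurable_fun_ifT => //; exact: measurable_fun_ler.
split => //.
- exact: measurable_funM.
- by move=> x _; case: (a <= x); rewrite ?lexx ?ler01.
- by move=> x _; case: (leP a x) => h; rewrite /= ?mulr1n ?mulr0n; lra.
- by move=> x y _ _; case: (leP a x) => ? ; case: (leP a y) => ?; rewrite /= ?mulr1n ?mulr0n; lra.
Qed.

(** A random price with density proportional to 1 / t on [c, a]: its revenue
    turns a bound on [Rev1] into one on a truncated mean without integrating tails. *)
Lemma log_price_mechanism1 (R : realType) (c a : R) : 0 < c -> c < a ->
  mechanism1 (fun x : R => ln (Num.max c (Num.min x a) / c) / ln (a / c))
             (fun x => (Num.max c (Num.min x a) - c) / ln (a / c)).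
Proof.
move=> c0 ca; have a0 : 0 < a by lra.
have L0 : 0 < ln (a / c) by rewrite ln_gt0// ltr_pdivlMr// mul1r.
set L := ln (a / c) in L0 *; pose z (x : R) := Num.max c (Num.min x a).
have zc x : c <= z x by rewrite /z le_max lexx.
have za x : z x <= a by rewrite /z ge_max ge_min lexx orbT ltW.
have z0 x : 0 < z x by apply: lt_le_trans (zc x).
have mz : measurable_fun setT z by apply: measurable_maxr => //; exact: measurable_minr.
have lnz x : ln (z x / c) = ln (z x) - ln c by rewrite ln_div ?posrE.
(* With z x in place of the factor x this is [ln u <= u - 1] at u = z y / z x. Clamping only helps:
   x < z x forces z x to be the least value c, and x > z x forces it to be the greatest value a. *)
have IC x y : (ln (z y) - ln (z x)) * x <= z y - z x.
  have h : (ln (z y) - ln (z x)) * z x <= z y - z x.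
    have := ln_le_sub1 (divr_gt0 (z0 y) (z0 x)); rewrite ln_div ?posrE//.
    move=> h; apply: le_trans (ler_wpM2r (ltW (z0 x)) h) _.
    by rewrite mulrBl mul1r divfK// gt_eqF.
  apply: le_trans h; rewrite -subr_le0 -mulrBr.
  have [xc|xc] := leP x c.
    have zx : z x = c by rewrite /z min_l; [rewrite max_l|lra].
    rewrite zx; apply: mulr_ge0_le0; last by lra.
    by rewrite subr_ge0 ler_ln ?posrE// -zx.
  have [xa|xa] := leP x a.
    by have -> : z x = x; [rewrite /z min_l// max_r// ltW|rewrite subrr mulr0].
  have zx : z x = a by rewrite /z (min_r (ltW xa)) (max_r (ltW ca)).
  rewrite zx; apply: mulr_le0_ge0; last by lra.
  by rewrite subr_le0 ler_ln ?posrE.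
have lnL : L = ln a - ln c by rewrite /L ln_div ?posrE.
split.
- apply: measurable_funM => //; apply: measurableT_comp => //.
  exact: measurable_funM.
- by apply: measurable_funM => //; exact: measurable_funB.
- move=> x _; rewrite -/(z x) lnz; apply/andP; split.
    by rewrite divr_ge0 ?(ltW L0)// subr_ge0 ler_ln ?posrE.
  by rewrite ler_pdivrMr// mul1r lnL lerB// ler_ln ?posrE.
- move=> x x0; rewrite -/(z x) lnz.
  have := IC x c.
  have -> : z c = c by rewrite /z max_l// ge_min lexx.
  move=> h; rewrite mulrAC -mulrBl divr_ge0 ?(ltW L0)//; lra.
- move=> x y x0 y0; rewrite -/(z x) -/(z y) !lnz !(mulrAC _ L^-1) -!mulrBl.
  by rewrite ler_pM2r ?invr_gt0//; have := IC x y; lra.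
Qed.

(** Random price on [1, +oo) with density proportional to t^(-3/2): shows that
    E sqrt X, hence E min(X1, X2), is finite. *)
Lemma sqrt_price_mechanism1 (R : realType) :
  mechanism1 (fun x : R => 1 - (Num.sqrt (Num.max 1 x))^-1)
               (fun x => Num.sqrt (Num.max 1 x) - 1).
Proof.
pose u (x : R) := Num.sqrt (Num.max 1 x).
have u1 x : 1 <= u x by rewrite -[leLHS]sqrtr1 ler_wsqrtr// le_max lexx.
have u0 x : 0 < u x by apply: lt_le_trans (u1 x).
have mu : measurable_fun setT u.
  apply: measurableT_comp; first by apply: continuous_measurable_fun; exact: sqrt_continuous.
  exact: measurable_maxr.
have muV : measurable_fun setT (fun x => (u x)^-1).
  rewrite (_ : (fun _ => _) = fun x => expR (- ln (u x))); last first.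
    by apply/funext => x; rewrite expRN lnK// posrE.
  do 2 apply: measurableT_comp => //.
  by apply: measurableT_comp.
have IC x y : x * ((u x)^-1 - (u y)^-1) <= u y - u x.
  have uy1 := u1 y; have uy0 := u0 y.
  have [x1|x1] := leP x 1.
    have -> : u x = 1 by rewrite /u max_l// sqrtr1.
    have h : 0 <= 1 - (u y)^-1 by rewrite subr_ge0 invf_le1.
    rewrite invr1; apply: le_trans (ler_wpM2r h x1) _; rewrite mul1r.
    have : u y * (u y)^-1 = 1 by rewrite divff// gt_eqF.
    by nra.
  have xE : x = u x ^+ 2 by rewrite /u max_r ?sqr_sqrtr//; lra.
  have := u0 x; move: xE; set v := u x => -> v0.
  rewrite -subr_ge0 (_ : _ - _ = (u y - v) ^+ 2 / u y).
    by rewrite divr_ge0 ?sqr_ge0// ltW.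
  by field; rewrite !gt_eqF.
split.
- exact: measurable_funB.
- exact: measurable_funB.
- move=> x _; have := u0 x; have := u1 x; rewrite -/(u x) => ux1 ux0.
  by rewrite subr_ge0 invf_le1// ux1 gerBl invr_ge0 ltW.
- move=> x x0; have := IC x 1; rewrite -/(u x).
  have -> : u 1 = 1 by rewrite /u max_l// sqrtr1.
  rewrite invr1; lra.
- move=> x y _ _; have := IC x y; rewrite -/(u x) -/(u y); lra.
Qed.

(** * Pointwise decomposition of a two-good payment *)

Section two_goods.
Variable R : realType.

Definition payoff (q1 q2 s : R * R -> R) (x : R * R) := q1 x * x.1 + q2 x * x.2 - s x.

(** On the region this is q1 x1 - b(x) + b(x2, x2), b being the payoff. *)
Definition good1_payment (q1 q2 s : R * R -> R) (x : R * R) :=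
  if (0 <= x.2) && (x.2 <= x.1) then s x - q2 x * x.2 + payoff q1 q2 s (x.2, x.2)
  else 0.

Lemma mechanism2_swap (q1 q2 s : R * R -> R) : mechanism2 q1 q2 s ->
  mechanism2 (q2 \o swap_pair) (q1 \o swap_pair) (s \o swap_pair).
Proof.
move=> [[mq1 mq2] ms q01 IR IC].
have msw : measurable_fun setT (@swap_pair R R) by apply: measurable_fun_pair.
split.
- by split; exact: measurableT_comp.
- exact: measurableT_comp.
- by move=> [x y] /= x0 y0; have [] := q01 (y, x) y0 x0.
- by move=> [x y] /= x0 y0; have := IR (y, x) y0 x0; rewrite /=; lra.
- move=> [x y] [x' y'] /= x0 y0 x'0 y'0.
  have := IC (y, x) (y', x') y0 x0 y'0 x'0; rewrite /swap_pair /=; lra.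
Qed.

Section fixed_mechanism.
Variables q1 q2 s : R * R -> R.
Hypothesis mech : mechanism2 q1 q2 s.

(** Type (y, y) gains nothing by reporting (x, y), which makes the nonzero branch at least q1(x, y)
    y. *)
Lemma good1_payment_ge0 x : 0 <= good1_payment q1 q2 s x.
Proof.
have [_ _ q01 _ IC] := mech; rewrite /good1_payment; case: ifPn => // /andP[y0 yx].
case: x y0 yx => x y /= y0 yx; have x0 := le_trans y0 yx.
have := IC (y, y) (x, y) y0 y0 x0 y0; rewrite /payoff/=.
have [/andP[q10 _] _] := q01 (x, y) x0 y0.
have := mulr_ge0 q10 y0; lra.
Qed.

Lemma measurable_good1_payment : measurable_fun setT (good1_payment q1 q2 s).
Proof.
have [[mq1 mq2] ms _ _ _] := mech.
have mdiag : measurable_fun setT (fun x : R * R => (x.2, x.2)).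
  by apply: measurable_fun_pair; exact: measurable_snd.
have mf : measurable_fun setT (@fst R R) by exact: measurable_fst.
have msnd : measurable_fun setT (@snd R R) by exact: measurable_snd.
apply: measurable_fun_ifT => //.
- apply: measurable_and; exact: measurable_fun_ler.
- apply: measurable_funD.
    by apply: measurable_funB => //; exact: measurable_funM.
  apply: (measurableT_comp (f := payoff q1 q2 s)) => //.
  apply: measurable_funB => //; apply: measurable_funD; exact: measurable_funM.
Qed.

(** A type x >= y gets b(x, y) - b(y, y), nonnegative because b is monotone in x, and a lower type
    gets 0. A type below y cannot profit from reporting x' >= y, since type y already does not. *)
Lemma good1_payment_mechanism1 y : 0 <= y ->
  mechanism1 (fun x => if y <= x then q1 (x, y) else 0)
               (fun x => good1_payment q1 q2 s (x, y)).
Proof.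
move=> y0; have [[mq1 mq2] ms q01 IR IC] := mech.
have mp : measurable_fun setT (fun x : R => (x, y)) by exact: measurable_fun_pair.
have b_nd x : y <= x -> payoff q1 q2 s (y, y) <= payoff q1 q2 s (x, y).
  move=> yx; have x0 := le_trans y0 yx.
  have := IC (x, y) (y, y) x0 y0 y0 y0; rewrite /payoff/=.
  have [/andP[q10 _] _] := q01 (y, y) y0 y0.
  have : 0 <= q1 (y, y) * (x - y) by rewrite mulr_ge0// subr_ge0.
  lra.
split.
- apply: measurable_fun_ifT => //; first exact: measurable_fun_ler.
  exact: measurableT_comp.
- by apply: (measurableT_comp (f := good1_payment q1 q2 s)) => //; exact: measurable_good1_payment.
- move=> x x0; case: ifP => _; last by rewrite lexx ler01.
  by have [] := q01 (x, y) x0 y0.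
- move=> x x0; rewrite /good1_payment /= y0 /=; case: (leP y x) => yx; last by lra.
  by have := b_nd x yx; rewrite /payoff/=; lra.
- move=> x x' x0 x'0; rewrite /good1_payment /= y0 /=.
  case: (leP y x') => yx'; case: (leP y x) => yx.
  + by have := IC (x, y) (x', y) x0 y0 x'0 y0; rewrite /payoff/=; lra.
  + have := IC (y, y) (x', y) y0 y0 x'0 y0; rewrite /payoff/=.
    have [/andP[q10 _] _] := q01 (x', y) x'0 y0.
    have : 0 <= q1 (x', y) * (y - x) by rewrite mulr_ge0// subr_ge0 ltW.
    lra.
  + by have := b_nd x yx; rewrite /payoff/=; lra.
  + lra.
Qed.

End fixed_mechanism.

Definition capped_min (a : R) (x : R * R) : R :=
  (a <= Num.max x.1 x.2)%R%:R * Num.min (Num.min x.1 x.2) a.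

Lemma payment_decomposition (q1 q2 s : R * R -> R) (n : nat) :
  mechanism2 q1 q2 s -> (0 < n)%N ->
  exists a : nat -> R, (forall j, 0 <= a j) /\
    forall x, 0 <= x.1 -> 0 <= x.2 ->
    s x <= good1_payment q1 q2 s x +
      good1_payment (q2 \o swap_pair) (q1 \o swap_pair) (s \o swap_pair) (swap_pair x) +
      Num.min x.1 x.2 / n%:R + n%:R^-1 * \sum_(j < n) capped_min (a j) x.
Proof.
move=> mech n0; have [_ _ q01 IR IC] := mech.
pose B y := payoff q1 q2 s (y, y).
(* Capping at 1 keeps the levels within [0, 1]; it is harmless because the single allocation
   probability to be bounded is at most 1. *)
pose q t := Num.min (q1 (t, t) + q2 (t, t)) 1.
have hq01 t : 0 <= t -> 0 <= q t <= 1.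
  move=> t0; have [/andP[h1 _] /andP[h2 _]] := q01 (t, t) t0 t0.
  by rewrite /q le_min ge_min lexx orbT ler01 !andbT addr_ge0.
have hB0 t : 0 <= t -> 0 <= B t by move=> t0; exact: IR.
have hBq t t' : 0 <= t -> t <= t' -> B t + q t * (t' - t) <= B t'.
  move=> t0 tt'; have t'0 : 0 <= t' by lra.
  have := IC (t', t') (t, t) t'0 t'0 t0 t0; rewrite /B /payoff/=.
  have : q t * (t' - t) <= (q1 (t, t) + q2 (t, t)) * (t' - t).
    by rewrite ler_wpM2r ?subr_ge0// /q ge_min lexx.
  lra.
have [a [a0 aP]] := layer_cake_bound hq01 hB0 hBq n0.
exists a; split => // -[x1 x2] /= x10 x20.
(* In each case below the payment of the more valued good does the work; of the other only the sign
   matters. *)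
have p1 := good1_payment_ge0 mech (x1, x2).
have p2 := good1_payment_ge0 (mechanism2_swap mech) (x2, x1).
have [x21|x12] := leP x2 x1.
- have := aP x2 x1 x20 x21.
  have h1 := IC (x1, x2) (x1, x1) x10 x20 x10 x10.
  have h2 := IC (x1, x1) (x1, x2) x10 x10 x10 x20.
  rewrite /= in h1 h2.
  (* Adding the two incentive constraints shows that raising the second value from x2 to x1 does not
     lower q2; for x1 = x2 the bound follows from q1 >= 0. *)
  have hq : q2 (x1, x2) <= q x1.
    rewrite /q le_min; have [/andP[q0 _] _] := q01 (x1, x1) x10 x10.
    have [_ /andP[_ ->]] := q01 (x1, x2) x10 x20; rewrite andbT.
    have [->|ne] := eqVneq x2 x1; first by lra.
    have lt : 0 < x1 - x2 by rewrite subr_gt0 lt_neqAle ne.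
    have : q2 (x1, x2) <= q2 (x1, x1) by rewrite -(ler_pM2r lt); lra.
    lra.
  have hq' := ler_wpM2r x20 hq.
  rewrite /swap_pair /= (_ : good1_payment _ _ _ (x1, x2) = s (x1, x2) - q2 (x1, x2) * x2 + B x2).
    rewrite (eq_bigr (fun j : 'I_n => capped_min (a j) (x1, x2))); first by lra.
    by move=> j _; rewrite /capped_min/= (max_l x21) (min_r x21).
  by rewrite /good1_payment /= x20 x21.
- have {}x12 := ltW x12.
  have := aP x1 x2 x10 x12.
  have h1 := IC (x1, x2) (x2, x2) x10 x20 x20 x20.
  have h2 := IC (x2, x2) (x1, x2) x20 x20 x10 x20.
  rewrite /= in h1 h2.
  have hq : q1 (x1, x2) <= q x2.
    rewrite /q le_min; have [_ /andP[q0 _]] := q01 (x2, x2) x20 x20.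
    have [/andP[_ ->] _] := q01 (x1, x2) x10 x20; rewrite andbT.
    have [->|ne] := eqVneq x1 x2; first by lra.
    have lt : 0 < x2 - x1 by rewrite subr_gt0 lt_neqAle ne.
    have : q1 (x1, x2) <= q1 (x2, x2) by rewrite -(ler_pM2r lt); lra.
    lra.
  have hq' := ler_wpM2r x10 hq.
  rewrite /swap_pair /= (_ : good1_payment _ _ _ (x2, x1) = s (x1, x2) - q1 (x1, x2) * x1 + B x1).
    rewrite (eq_bigr (fun j : 'I_n => capped_min (a j) (x1, x2))); first by lra.
    by move=> j _; rewrite /capped_min/= (max_r x12) (min_l x12).
  by rewrite /good1_payment /= x10 x12 /B /payoff /=; lra.
Qed.

End two_goods.

(** * Integration under independence *)

Lemma probability_inhabited (R : realType) (d : measure_display)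
  (T : measurableType d) (P : probability T R) : [set: T] !=set0.
Proof.
apply/set0P/eqP => T0; have := probability_setT P.
by rewrite T0 measure0 => /eqP; rewrite eq_sym onee_eq0.
Qed.

Section independence.
Context (R : realType) (d : measure_display) (T : measurableType d).
Variables (P : probability T R) (X1 X2 : T -> R).
Hypotheses (mX1 : measurable_fun setT X1) (mX2 : measurable_fun setT X2).
Hypothesis ind : independent2 P X1 X2.

(** Independence makes the law of the pair agree with the product of the marginal laws on
    rectangles, hence everywhere; Tonelli then applies. *)
Lemma integral_independent (f : R * R -> R) :
  measurable_fun setT f -> (forall x, 0 <= f x) ->
  (\int[P]_w (f (X1 w, X2 w))%:E =
   \int[P]_w' \int[P]_w (f (X1 w, X2 w'))%:E)%E.
Proof.
move=> mf f0.
pose Y1 : {mfun T >-> R} := HB.pack X1 (isMeasurableFun.Build _ _ _ _ _ mX1).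
pose Y2 : {mfun T >-> R} := HB.pack X2 (isMeasurableFun.Build _ _ _ _ _ mX2).
have mY : measurable_fun setT (fun w => (X1 w, X2 w)) by exact: measurable_fun_pair.
pose Y : {mfun T >-> (R * R)%type} := HB.pack (fun w => (X1 w, X2 w)) (isMeasurableFun.Build _ _ _ _ _ mY).
pose Ef := fun x : R * R => (f x)%:E.
have mEf : measurable_fun setT Ef by exact/measurable_EFinP.
have Ef0 x : (0 <= Ef x)%E by rewrite lee_fin.
transitivity (\int[distribution P Y]_x Ef x)%E.
  by rewrite ge0_integral_distribution.
transitivity (\int[distribution P Y1 \x distribution P Y2]_x Ef x)%E.
  apply: eq_measure_integral => A mA _; apply/esym.
  apply: product_measure_unique => // B C mB mC.
rewrite fubini_tonelli2//= ge0_integral_distribution//.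
- apply: eq_integral => w _; rewrite /= /fubini_G ge0_integral_distribution//.
  by apply: measurableT_comp => //; exact: measurable_fun_pair.
- exact: measurable_fun_fubini_tonelli_G.
- by move=> y; apply: integral_ge0 => x _.
Qed.

(** Allows a bound to be proved with the second good frozen at any of its values. *)
Lemma integral_independent_le (f : R * R -> R) (r : \bar R) :
  measurable_fun setT f -> (forall x, 0 <= f x) ->
  (forall w', \int[P]_w (f (X1 w, X2 w'))%:E <= r)%E ->
  (\int[P]_w (f (X1 w, X2 w))%:E <= r)%E.
Proof.
move=> mf f0 fr; rewrite integral_independent//.
apply: (@le_trans _ _ (\int[P]_w' cst r w')%E); last first.
  rewrite integral_cst// [X in (r * X)%E](_ : _ = 1%E) ?mule1//.
  exact: probability_setT.
have r0 : (0 <= r)%E.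
  have [w _] := probability_inhabited P.
  by apply: le_trans (fr w); apply: integral_ge0 => ? _; rewrite lee_fin.
apply: ge0_le_integral => //.
- by move=> w _; apply: integral_ge0 => ? _; rewrite lee_fin.
- pose g := fun w : T * T => (f (X1 w.1, X2 w.2))%:E.
  have := @measurable_fun_fubini_tonelli_G _ _ T T R P g; apply => //.
    apply/measurable_EFinP; apply: measurableT_comp => //.
    by apply: measurable_fun_pair; apply: measurableT_comp.
  by move=> x; rewrite lee_fin.
Qed.

Lemma integral_independentM (g1 g2 : R -> R) :
  measurable_fun setT g1 -> measurable_fun setT g2 ->
  (forall x, 0 <= g1 x) -> (forall x, 0 <= g2 x) ->
  (\int[P]_w (g1 (X1 w) * g2 (X2 w))%:E =
   \int[P]_w (g1 (X1 w))%:E * \int[P]_w (g2 (X2 w))%:E)%E.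
Proof.
move=> m1 m2 g10 g20.
have mf : measurable_fun setT (fun x : R * R => g1 x.1 * g2 x.2).
  by apply: measurable_funM; apply: measurableT_comp.
rewrite (integral_independent mf); last by move=> x; rewrite mulr_ge0.
under eq_integral => w' _.
  under eq_integral => w _ do rewrite /= mulrC EFinM.
  rewrite ge0_integralZl_EFin//; last 2 first.
    by move=> w _; rewrite lee_fin.
    by apply/measurable_EFinP; exact: measurableT_comp.
  rewrite muleC; over.
rewrite ge0_integralZl//.
- by apply/measurable_EFinP; exact: measurableT_comp.
- by move=> w _; rewrite lee_fin.
- by apply: integral_ge0 => w _; rewrite lee_fin.
Qed.

End independence.

(** * Upper bounds on means of nonnegative variables *)

Section integral.
Context (R : realType) (d : measure_display) (T : measurableType d).
Variables (P : probability T R).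

(** Meant for [f] a payment, possibly negative and not known to be integrable: the comparison goes
    through its positive part. *)
Lemma integral_le_ge0 (f g : T -> R) :
  measurable_fun setT f -> measurable_fun setT g -> (forall w, 0 <= g w) ->
  (forall w, f w <= g w) ->
  (\int[P]_w (f w)%:E <= \int[P]_w (g w)%:E)%E.
Proof.
move=> mf mg g0 fg; rewrite integralE.
apply: (@le_trans _ _ (\int[P]_w ((EFin \o f)^\+ w))%E).
  by rewrite -[leRHS]adde0; apply: leeD2l; rewrite oppe_le0 integral_ge0.
apply: ge0_le_integral => //.
- by apply: measurable_funepos; exact/measurable_EFinP.
- exact/measurable_EFinP.
- by move=> w _; rewrite funeposE /= -EFin_max lee_fin ge_max fg g0.
Qed.

End integral.

Section mean_bound.
Context (R : realType) (d : measure_display) (T : measurableType d).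
Variables (P : probability T R).

(** Measurability and nonnegativity are bundled in so that sums and scalings raise no integrability
    conditions. *)
Definition mean_le (f : T -> R) (a : R) : Prop :=
  [/\ measurable_fun setT f, (forall w, 0 <= f w) &
      (\int[P]_w (f w)%:E <= a%:E)%E].

Lemma mean_le_cst a : 0 <= a -> mean_le (fun=> a) a.
Proof.
move=> a0; split => //; rewrite (integral_cst P measurableT a%:E).
by rewrite [X in (_ * X)%E](_ : _ = 1%E) ?mule1//; exact: probability_setT.
Qed.

Lemma mean_leD (f g : T -> R) (a b : R) : mean_le f a -> mean_le g b ->
  mean_le (fun w => f w + g w) (a + b).
Proof.
move=> [mf f0 fa] [mg g0 gb]; split.
- exact: measurable_funD.
- by move=> w; rewrite addr_ge0.
- under eq_integral do rewrite EFinD.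
  rewrite ge0_integralD//; last 4 first.
  + by move=> w _; rewrite lee_fin.
  + exact/measurable_EFinP.
  + by move=> w _; rewrite lee_fin.
  + exact/measurable_EFinP.
  by rewrite EFinD leeD.
Qed.

Lemma mean_leZ (f : T -> R) (a k : R) : 0 <= k -> mean_le f a -> mean_le (fun w => k * f w) (k * a).
Proof.
move=> k0 [mf f0 fa]; split.
- exact: measurable_funM.
- by move=> w; rewrite mulr_ge0.
- under eq_integral do rewrite EFinM.
  rewrite ge0_integralZl_EFin//; last 2 first.
  + by move=> w _; rewrite lee_fin.
  + exact/measurable_EFinP.
  by rewrite EFinM; apply: lee_wpmul2l => //; rewrite lee_fin.
Qed.

Lemma mean_le_sum (f : nat -> T -> R) (a : R) (n : nat) : (forall j, mean_le (f j) a) ->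
  mean_le (fun w => \sum_(j < n) f j w) (n%:R * a).
Proof.
move=> fa; elim: n => [|n IH].
  rewrite mul0r (_ : (fun _ => _) = (fun=> 0)); first exact: mean_le_cst.
  by apply/funext => w; rewrite big_ord0.
rewrite (_ : (fun _ => _) = (fun w => \sum_(j < n) f j w + f n w)); last first.
  by apply/funext => w; rewrite big_ord_recr.
by rewrite -natr1 mulrDl mul1r; exact: mean_leD.
Qed.

Lemma mean_leW (f g : T -> R) (a : R) : measurable_fun setT f -> (forall w, 0 <= f w) ->
  (forall w, f w <= g w) -> mean_le g a -> mean_le f a.
Proof.
move=> mf f0 fg [mg g0 ga]; split=> //; apply: le_trans ga.
exact: integral_le_ge0.
Qed.

Lemma integral_bounded (f : T -> R) (M : R) : measurable_fun setT f ->
  (forall w, 0 <= f w <= M) ->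
  exists2 m, 0 <= m <= M & (\int[P]_w (f w)%:E = m%:E)%E.
Proof.
move=> mf fM.
have f0 w : 0 <= f w by have /andP[] := fM w.
have M0 : 0 <= M.
  have [w _] := probability_inhabited P.
  by have /andP[/le_trans] := fM w; apply.
have [_ _ fle] : mean_le f M.
  by apply: mean_leW (mean_le_cst M0) => // w; have /andP[] := fM w.
have i0 : (0 <= \int[P]_w (f w)%:E)%E by apply: integral_ge0 => w _; rewrite lee_fin.
have fin : (\int[P]_w (f w)%:E)%E \is a fin_num.
  by rewrite ge0_fin_numE// (le_lt_trans fle)// ltry.
exists (fine (\int[P]_w (f w)%:E)); last by rewrite fineK.
by rewrite fine_ge0//= -lee_fin fineK.
Qed.

End mean_bound.

(** * Truncated valuations *)

(** The outer maximum gives nonnegativity on all of R, as [integral_independentM] asks; for a > 0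
    and x >= 0 the value is min(x, a). *)
Definition trunc {R : realType} (a x : R) : R := Num.max 0 (Num.min x a).
Definition above {R : realType} (a x : R) : R := (a <= x)%R%:R.
Definition trunc_below {R : realType} (a x : R) : R := (1 - above a x) * trunc a x.

Section truncation.
Variables (R : realType) (a : R).
Hypothesis a0 : 0 < a.

Lemma above01 x : 0 <= above a x <= 1.
Proof. by rewrite /above; case: (a <= x); rewrite ?lexx ?ler01. Qed.

Lemma trunc_itv x : 0 <= trunc a x <= a.
Proof. by rewrite /trunc le_max lexx ge_max ge_min lexx orbT (ltW a0). Qed.

Lemma trunc_belowE x : trunc a x = trunc_below a x + a * above a x.
Proof.
rewrite /trunc_below /above /trunc; case: (leP a x) => ax /=; last by rewrite mulr0n; lra.
by rewrite (max_r (ltW a0)) mulr1n; lra.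
Qed.

Lemma trunc_below_itv x : 0 <= trunc_below a x <= a.
Proof.
have := trunc_itv x; have := above01 x; rewrite /trunc_below.
by move=> /andP[h1 h2] /andP[h3 h4]; apply/andP; split; nra.
Qed.

Lemma measurable_above : measurable_fun setT (above a).
Proof.
rewrite (_ : above a = (fun x => if a <= x then 1 else 0)); last first.
  by apply/funext => x; rewrite /above; case: (a <= x).
by apply: measurable_fun_ifT => //; exact: measurable_fun_ler.
Qed.

Lemma measurable_trunc : measurable_fun setT (trunc a).
Proof. by apply: measurable_maxr => //; exact: measurable_minr. Qed.

Lemma measurable_trunc_below : measurable_fun setT (trunc_below a).
Proof.
apply: measurable_funM; last exact: measurable_trunc.
by apply: measurable_funB => //; exact: measurable_above.
Qed.

(** If x1 >= a, the capped minimum is min(x2, a); if x1 < a, the indicator forces x2 >= a and the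
    minimum is x1. Each summand is a product over the two goods, which independence factors. *)
Lemma capped_minE (x : R * R) : 0 <= x.1 -> 0 <= x.2 ->
  capped_min a x = above a x.1 * trunc a x.2 + trunc_below a x.1 * above a x.2.
Proof.
case: x => x y /= x0 y0; rewrite /capped_min /trunc_below /above /trunc /=.
case: (leP a x) => ax.
- rewrite le_max ax /= mulr1n subrr !mul0r addr0 !mul1r max_r; last first.
    by rewrite le_min y0 ltW.
  by have [?|?] := leP x y; have [?|?] := leP y a; have [?|?] := leP x a; lra.
- rewrite le_max (lt_geF ax) /= mulr0n !mul0r subr0 add0r mul1r.
  case: (leP a y) => ay; rewrite ?mulr0n ?mulr1n; last by rewrite mul0r mulr0.
  by rewrite mul1r mulr1 max_r// (min_l (ltW (lt_le_trans ax ay))) min_l// ltW.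
Qed.

End truncation.

(** * Tails and truncated means of a good with bounded revenue *)

Section one_good.
Context (R : realType) (d : measure_display) (T : measurableType d).
Variables (P : probability T R) (Y : T -> R) (r : R).
Hypothesis mY : measurable_fun setT Y.
Hypotheses (r0 : 0 < r) (RevY : (Rev1 P Y <= r%:E)%E).

Lemma mechanism1_revenue q s : mechanism1 q s ->
  (\int[P]_w (s (Y w))%:E <= r%:E)%E.
Proof.
move=> qs; apply: le_trans RevY; apply: ereal_sup_ubound.
by exists q, s.
Qed.

Lemma mean_mechanism1 q s : mechanism1 q s -> (forall x, 0 <= s x) ->
  mean_le P (s \o Y) r.
Proof.
move=> qs s0; split; first by have [_ ms _ _ _] := qs; exact: measurableT_comp.
- by move=> w; exact: s0.
- exact: mechanism1_revenue qs.
Qed.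

Lemma mean_sqrt : mean_le P (Num.sqrt \o Y) (1 + r).
Proof.
have h : mean_le P (fun w => 1 + (Num.sqrt (Num.max 1 (Y w)) - 1)) (1 + r).
  apply: mean_leD; first exact: mean_le_cst.
  apply: (mean_mechanism1 (sqrt_price_mechanism1 R)) => x.
  by rewrite subr_ge0 -[leLHS]sqrtr1 ler_wsqrtr// le_max lexx.
apply: mean_leW h.
- apply: measurableT_comp => //.
  by apply: continuous_measurable_fun; exact: sqrt_continuous.
- by move=> w /=; exact: sqrtr_ge0.
- by move=> w /=; rewrite addrC subrK ler_wsqrtr// le_max lexx orbT.
Qed.

Lemma mean_trunc a : 0 < a -> r < a ->
  mean_le P (trunc a \o Y) (r * (1 + ln (a / r))).
Proof.
move=> a0 ra.
have L0 : 0 < ln (a / r) by rewrite ln_gt0// ltr_pdivlMr// mul1r.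
(* With random prices from r to a, r plus ln (a / r) times the payment is max(r, min(Y, a)), which
   dominates [trunc a]. *)
have h : mean_le P (fun w => r + ln (a / r) *
    ((Num.max r (Num.min (Y w) a) - r) / ln (a / r))) (r + ln (a / r) * r).
  apply: mean_leD; first by apply: mean_le_cst; exact: ltW.
  apply: mean_leZ; first exact: ltW.
  apply: (mean_mechanism1 (log_price_mechanism1 r0 ra)) => x.
  by rewrite divr_ge0 ?(ltW L0)// subr_ge0 le_max lexx.
rewrite mulrDr mulr1 (mulrC r (ln _)).
apply: mean_leW h.
- by apply: measurableT_comp => //; exact: measurable_trunc.
- by move=> w; have /andP[] := trunc_itv a0 (Y w).
- move=> w /=; rewrite mulrCA divff ?gt_eqF// mulr1 addrC subrK.
  by rewrite /trunc ge_max !le_max lexx orbT (ltW r0).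
Qed.

(** Supplies the numbers that [trunc_cross_bound] takes: posting the price a earns a p <= r, and the
    part of the truncation below a has mean m - a p. *)
Lemma trunc_moments a : 0 < a -> exists p m : R,
  [/\ 0 <= p <= 1, a * p <= r, a * p <= m <= a &
    r < a -> m <= r * (1 + ln (a / r))] /\
  [/\ (\int[P]_w (above a (Y w))%:E = p%:E)%E,
    (\int[P]_w (trunc a (Y w))%:E = m%:E)%E &
    (\int[P]_w (trunc_below a (Y w))%:E = (m - a * p)%:E)%E].
Proof.
move=> a0.
have mA : measurable_fun setT (above a \o Y).
  by apply: measurableT_comp => //; exact: measurable_above.
have mB : measurable_fun setT (trunc_below a \o Y).
  by apply: measurableT_comp => //; exact: measurable_trunc_below.
have [p p01 pE] := integral_bounded P mA (fun w => above01 a (Y w)).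
have [n /andP[n0 _] nE] :=
  integral_bounded P mB (fun w => trunc_below_itv a0 (Y w)).
have [m /andP[_ ma] mE] := integral_bounded P
  (measurableT_comp (measurable_trunc a) mY) (fun w => trunc_itv a0 (Y w)).
have apE : (\int[P]_w (a * above a (Y w))%:E = (a * p)%:E)%E.
  under eq_integral do rewrite EFinM.
  rewrite ge0_integralZl_EFin ?pE//; last exact: ltW.
  - by move=> w _; rewrite lee_fin; have /andP[] := above01 a (Y w).
  - exact/measurable_EFinP.
have mnp : m = n + a * p.
  apply: EFin_inj; rewrite -mE /= EFinD -nE -apE -ge0_integralD//.
  - by apply: eq_integral => w _; rewrite /= -EFinD trunc_belowE.
  - by move=> w _; rewrite lee_fin; have /andP[] := trunc_below_itv a0 (Y w).
  - exact/measurable_EFinP.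
  - by move=> w _; rewrite lee_fin mulr_ge0 ?(ltW a0)//.
  - by apply/measurable_EFinP; exact: measurable_funM.
exists p, m; split; split => //.
- by rewrite -lee_fin -apE; exact: mechanism1_revenue (posted_price_mechanism1 (ltW a0)).
- by rewrite ma mnp andbT; lra.
- by move=> ra; have [_ _] := mean_trunc a0 ra; rewrite /= mE lee_fin.
- by rewrite nE mnp addrK.
Qed.

End one_good.

(** * Mean bounds for two independent goods *)

Section two_independent_goods.
Context (R : realType) (d : measure_display) (T : measurableType d).
Variables (P : probability T R) (X1 X2 : T -> R) (r1 r2 : R).
Hypotheses (mX1 : measurable_fun setT X1) (mX2 : measurable_fun setT X2).
Hypotheses (X10 : forall w, 0 <= X1 w) (X20 : forall w, 0 <= X2 w).
Hypothesis ind : independent2 P X1 X2.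
Hypotheses (r10 : 0 < r1) (r20 : 0 < r2).
Hypotheses (Rev_X1 : (Rev1 P X1 <= r1%:E)%E) (Rev_X2 : (Rev1 P X2 <= r2%:E)%E).

Lemma mean_capped_min a : 0 <= a ->
  mean_le P (fun w => capped_min a (X1 w, X2 w))
    ((r1 + r2) / Num.sqrt (expR 1)).
Proof.
have c0 : 0 <= (r1 + r2) / Num.sqrt (expR 1).
  by rewrite divr_ge0 ?sqrtr_ge0// addr_ge0// ltW.
rewrite le_eqVlt => /predU1P[<-|a0].
  (* A threshold 0, in particular the default one for a level never reached, gives the zero
     variable. *)
  rewrite (_ : (fun _ => _) = (fun=> 0)); first by apply: mean_leW (mean_le_cst P c0).
  by apply/funext => w; rewrite /capped_min/= min_r ?mulr0// le_min X10 X20.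
rewrite (_ : (fun _ => _) = (fun w => above a (X1 w) * trunc a (X2 w) +
    trunc_below a (X1 w) * above a (X2 w))); last first.
  by apply/funext => w; rewrite (@capped_minE _ a a0 (X1 w, X2 w) (X10 w) (X20 w)).
have [p1 [m1 [[p101 ap1 pm1 M1] [p1E m1E n1E]]]] :=
  trunc_moments mX1 r10 Rev_X1 a0.
have [p2 [m2 [[p201 ap2 pm2 M2] [p2E m2E n2E]]]] :=
  trunc_moments mX2 r20 Rev_X2 a0.
have A0 x : 0 <= above a x by have /andP[] := above01 a x.
have B0 x : 0 <= trunc_below a x by have /andP[] := trunc_below_itv a0 x.
have T0 x : 0 <= trunc a x by have /andP[] := trunc_itv a0 x.
have mA := measurable_above a; have mB := measurable_trunc_below a.
have mT := measurable_trunc a.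
have h : mean_le P (fun w => above a (X1 w) * trunc a (X2 w) +
    trunc_below a (X1 w) * above a (X2 w)) (p1 * m2 + (m1 - a * p1) * p2).
  apply: mean_leD; split.
  - by apply: measurable_funM; exact: measurableT_comp.
  - by move=> w; rewrite mulr_ge0.
  - by rewrite integral_independentM// p1E m2E.
  - by apply: measurable_funM; exact: measurableT_comp.
  - by move=> w; rewrite mulr_ge0.
  - by rewrite integral_independentM// n1E p2E.
have [mh h0 hle] := h; split => //; apply: le_trans hle _; rewrite lee_fin.
rewrite (mulrC _ p2).
exact: trunc_cross_bound.
Qed.

(** Uses min(x, y) <= sqrt x sqrt y, whose mean factors by independence. Any finite bound serves,
    since this mean is later divided by the number of levels. *)
Lemma mean_min : mean_le P (fun w => Num.min (X1 w) (X2 w)) ((1 + r1) * (1 + r2)).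
Proof.
have [ms1 s10 s1] := mean_sqrt mX1 Rev_X1.
have [ms2 s20 s2] := mean_sqrt mX2 Rev_X2.
have h : mean_le P (fun w => Num.sqrt (X1 w) * Num.sqrt (X2 w)) ((1 + r1) * (1 + r2)).
  split.
  - exact: measurable_funM.
  - by move=> w; rewrite mulr_ge0 ?sqrtr_ge0.
  - have msq : measurable_fun setT (@Num.sqrt R).
      by apply: continuous_measurable_fun; exact: sqrt_continuous.
    rewrite integral_independentM//; try by move=> x; exact: sqrtr_ge0.
    by rewrite EFinM lee_pmul//; apply: integral_ge0 => w _; rewrite lee_fin sqrtr_ge0.
apply: mean_leW h.
- exact: measurable_minr.
- by move=> w; rewrite le_min X10 X20.
- move=> w; rewrite -sqrtrM//.
  have m0 : 0 <= Num.min (X1 w) (X2 w) by rewrite le_min X10 X20.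
  rewrite -[leLHS](ger0_norm m0) -sqrtr_sqr ler_wsqrtr// expr2.
  by rewrite ler_pM// ge_min lexx ?orbT.
Qed.

End two_independent_goods.

(** * From the payment bound to the ratio of revenues *)

(** For each frozen value of X2 this is the revenue of a one-good mechanism from X1. *)
Lemma mean_good1_payment (R : realType) (d : measure_display) (T : measurableType d)
  (P : probability T R) (X1 X2 : T -> R) (q1 q2 s : R * R -> R) (r : R) :
  measurable_fun setT X1 -> measurable_fun setT X2 -> (forall w, 0 <= X2 w) ->
  independent2 P X1 X2 -> mechanism2 q1 q2 s -> (Rev1 P X1 <= r%:E)%E ->
  mean_le P (fun w => good1_payment q1 q2 s (X1 w, X2 w)) r.
Proof.
move=> mX1 mX2 X20 ind mech Rev_X1.
have mp := measurable_good1_payment mech.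
split.
- by apply: (measurableT_comp mp); exact: measurable_fun_pair.
- by move=> w; exact: good1_payment_ge0.
- apply: integral_independent_le => //; first by move=> x; exact: good1_payment_ge0.
  move=> w'; apply: le_trans Rev_X1; apply: ereal_sup_ubound.
  by do 2 eexists; split; [exact: (good1_payment_mechanism1 mech (X20 w'))|].
Qed.

Lemma independent2_sym (R : realType) (d : measure_display) (T : measurableType d)
  (P : probability T R) (X1 X2 : T -> R) :
  independent2 P X1 X2 -> independent2 P X2 X1.
Proof. by move=> ind A B mA mB; rewrite setIC ind// muleC. Qed.

Lemma mechanism2_revenue (R : realType) (d : measure_display) (T : measurableType d)
  (P : probability T R) (X1 X2 : T -> R) (q1 q2 s : R * R -> R) (r1 r2 : R) :
  measurable_fun setT X1 -> measurable_fun setT X2 ->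
  (forall w, 0 <= X1 w) -> (forall w, 0 <= X2 w) -> independent2 P X1 X2 ->
  0 < r1 -> 0 < r2 -> (Rev1 P X1 <= r1%:E)%E -> (Rev1 P X2 <= r2%:E)%E ->
  mechanism2 q1 q2 s ->
  (\int[P]_w (s (X1 w, X2 w))%:E <= (r1 + r2 + (r1 + r2) / Num.sqrt (expR 1))%:E)%E.
Proof.
move=> mX1 mX2 X10 X20 ind r10 r20 Rev_X1 Rev_X2 mech.
apply/lee_addgt0Pr => e e0; rewrite -EFinD.
set C := (1 + r1) * (1 + r2); have C0 : 0 < C by rewrite mulr_gt0//; lra.
(* More than C / e levels bring the rounding error, of mean at most C / n, down to e. *)
pose n := (Num.truncn (C / e)).+1.
have n0 : 0 < n%:R :> R by rewrite ltr0n.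
have Cn : C / n%:R <= e.
  by rewrite ler_pdivrMr// mulrC -ler_pdivrMr// ltW// truncnS_gt.
have [a [a0 sle]] := @payment_decomposition _ _ _ _ n mech (ltn0Sn _).
set c := (r1 + r2) / _.
have h1 := mean_good1_payment mX1 mX2 X20 ind mech Rev_X1.
have h2 := mean_good1_payment mX2 mX1 X10
  (independent2_sym ind) (mechanism2_swap mech) Rev_X2.
have h3 := mean_min mX1 mX2 X10 X20 ind Rev_X1 Rev_X2.
have h4 := mean_le_sum n (fun j =>
  mean_capped_min mX1 mX2 X10 X20 ind r10 r20 Rev_X1 Rev_X2 (a0 j)).
have nV0 : 0 <= n%:R^-1 :> R by rewrite invr_ge0 ltW.
have := mean_leD (mean_leD (mean_leD h1 h2) (mean_leZ nV0 h3)) (mean_leZ nV0 h4).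
move=> [mg g0 gle].
have [_ ms _ _ _] := mech.
apply: (@le_trans _ _ _ _ _ (integral_le_ge0 _ _ mg g0 _)).
- by apply: (measurableT_comp ms); exact: measurable_fun_pair.
- move=> w; have := sle (X1 w, X2 w) (X10 w) (X20 w).
  by rewrite /= (mulrC _ n%:R^-1).
- apply: le_trans gle _; rewrite lee_fin mulKf ?gt_eqF// -/c -/C.
  by rewrite (mulrC _ C); lra.
Qed.

Theorem theorem1 (R : realType) (d : measure_display) (T : measurableType d)
  (P : probability T R) (X1 X2 : T -> R) :
  measurable_fun setT X1 -> measurable_fun setT X2 ->
  (forall w, 0 <= X1 w) -> (forall w, 0 <= X2 w) ->
  independent2 P X1 X2 ->
  ((Num.sqrt (expR 1) / (Num.sqrt (expR 1) + 1))%:E * Rev2 P X1 X2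
     <= SRev2 P X1 X2)%E.
Proof.
move=> mX1 mX2 X10 X20 ind; rewrite /SRev2.
set E := Num.sqrt (expR 1).
have E0 : 0 < E by rewrite sqrtr_gt0 expR_gt0.
(* The null mechanism rules out the value -oo. *)
have Rev_ge0 (Y : T -> R) : (0 <= Rev1 P Y)%E.
  apply: ereal_sup_ubound; exists (fun=> 0), (fun=> 0); split; last by rewrite integral0.
  by split => // *; rewrite ?lexx ?ler01; lra.
have := Rev_ge0 X1; have := Rev_ge0 X2.
(* An infinite separate revenue makes the claim trivial. *)
case R1E : (Rev1 P X1) => [r1| |]; case R2E : (Rev1 P X2) => [r2| |] //; try by rewrite ?leey.
rewrite !lee_fin => r20 r10.
apply/lee_addgt0Pr => e e0; rewrite -!EFinD.
rewrite muleC -lee_pdivlMr ?divr_gt0 ?addr_gt0//.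
apply: ge_ereal_sup => _ [q1 [q2 [s [mech ->]]]].
(* Adding e / 2 to each revenue makes both bounds positive, as [mechanism2_revenue] asks, even when
   a revenue is zero. *)
have e20 : 0 < e / 2 by rewrite divr_gt0.
apply: le_trans (mechanism2_revenue (r1 := r1 + e / 2) (r2 := r2 + e / 2)
  mX1 mX2 X10 X20 ind _ _ _ _ mech) _.
- by lra.
- by lra.
- by rewrite R1E lee_fin; lra.
- by rewrite R2E lee_fin; lra.
rewrite -/E -EFinM lee_fin invf_div.
rewrite le_eqVlt; apply/orP; left; apply/eqP.
by field; rewrite gt_eqF.
Qed.
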